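(* Let $\mathcal{H}$ be a real Hilbert space, let $A:\mathcal{H}\rightrightarrows\mathcal{H}$ be maximally monotone, let $D:\mathcal{H}\to\mathcal{H}$ be $L_D^{-1}$-cocoercive and $B:\mathcal{H}\to\mathcal{H}$ be $L_B^{-1}$-cocoercive, with $L_D,L_B>0$. Suppose that $\gamma,\lambda,\beta:[0,+\infty)\to(0,+\infty)$ are continuous on each interval $[0,b]$, $0<b<+\infty$. Then for every $u_0,v_0\in\mathcal{H}$ there exists a unique strong global solution $x:[0,+\infty)\to\mathcal{H}$ of the dynamical system $$\ddot{x}(t)+\gamma(t)\dot{x}(t)+x(t)=J_{\lambda(t)A}\big(x(t)-\lambda(t)D(x(t))-\lambda(t)\beta(t)B(x(t))\big),\qquad x(0)=u_0,\ \dot{x}(0)=v_0.$$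
   Context: A single-valued operator $T:\mathcal{H}\to\mathcal{H}$ is $\kappa$-cocoercive ($\kappa>0$) if $\langle x-y,Tx-Ty\rangle\ge\kappa\|Tx-Ty\|^2$ for all $x,y\in\mathcal{H}$. For a maximally monotone operator $A$ and $\alpha>0$, $J_{\alpha A}=(\mathrm{Id}+\alpha A)^{-1}:\mathcal{H}\to\mathcal{H}$ denotes the resolvent of $\alpha A$, i.e. $p=J_{\alpha A}(x)$ iff $x\in p+\alpha Ap$ (it is single-valued and everywhere defined). A function $x:[0,+\infty)\to\mathcal{H}$ is a strong global solution of the dynamical system if: (i) $x$ and $\dot{x}$ are locally absolutely continuous on $[0,+\infty)$, i.e. absolutely continuous on each interval $[0,b]$ with $0<b<+\infty$; (ii) the differential equation holds for almost every $t\ge0$; (iii) $x(0)=u_0$ and $\dot{x}(0)=v_0$. *)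

(* Defs.v *)
From HB Require Import structures.
From mathcomp Require Import all_boot all_order all_algebra.
From mathcomp Require Import all_classical all_reals all_analysis.

Set Implicit Arguments.
Unset Strict Implicit.
Unset Printing Implicit Defensive.

Import Order.TTheory GRing.Theory Num.Theory.
Import numFieldNormedType.Exports.

Local Open Scope classical_set_scope.
Local Open Scope ring_scope.

(* Set-valued operators on H are functions [A : H -> set H], with graph
   {(x, u) | A x u}. A real Hilbert space is a complete normed module over a
   [realType] with an inner product inducing its norm. *)

Definition hilbert_norm (R : realType) (H : completeNormedModType R)
    (inner : {dot H for idfun}) : Prop :=
  forall x : H, `|x| = Num.sqrt (inner x x).

Definition monotone_op (R : realType) (H : completeNormedModType R)
    (inner : {dot H for idfun}) (A : H -> set H) : Prop :=
  forall x y u v, A x u -> A y v -> 0 <= inner (x - y) (u - v).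

Definition maximally_monotone (R : realType) (H : completeNormedModType R)
    (inner : {dot H for idfun}) (A : H -> set H) : Prop :=
  monotone_op inner A /\
  forall A' : H -> set H, monotone_op inner A' ->
    (forall x, A x `<=` A' x) -> A' = A.

Definition cocoercive (R : realType) (H : completeNormedModType R)
    (inner : {dot H for idfun}) (kappa : R) (T : H -> H) : Prop :=
  0 < kappa /\
  forall x y, inner (x - y) (T x - T y) >= kappa * `|T x - T y| ^+ 2.

Definition resolvent_graph (R : realType) (H : completeNormedModType R)
    (alpha : R) (A : H -> set H) (x : H) : set H :=
  [set p | [set p + alpha *: a | a in A p] x].

(* For [A] maximally monotone and [alpha > 0], [resolvent_graph alpha A x] is a
   singleton (Minty), and [resolvent alpha A x] is its element; the default
   value 0 only occurs when that set is empty. *)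
Definition resolvent (R : realType) (H : completeNormedModType R)
    (alpha : R) (A : H -> set H) (x : H) : H :=
  xget 0 (resolvent_graph alpha A x).

Definition absolutely_continuous_on (R : realType)
    (H : completeNormedModType R) (a b : R) (f : R -> H) : Prop :=
  forall e : R, 0 < e -> exists2 d : R, 0 < d &
    forall (n : nat) (l r : 'I_n -> R),
      (forall k, a <= l k /\ l k <= r k /\ r k <= b) ->
      trivIset setT (fun k => `]l k, r k[%classic) ->
      \sum_(k < n) (r k - l k) < d ->
      \sum_(k < n) `|f (r k) - f (l k)| < e.

Definition locally_absolutely_continuous (R : realType)
    (H : completeNormedModType R) (f : R -> H) : Prop :=
  forall b : R, 0 < b -> absolutely_continuous_on 0 b f.

(* Functions on [0, +oo) are represented by functions on R of which only the
   restriction to [0, +oo) is used. The derivative at t >= 0 is thus the limit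
   of the difference quotient at s -> t with s >= 0, s <> t: it is one-sided at
   t = 0. [deriv_nneg f t] is meaningful only if [derivable_nneg f t]. *)
Definition diff_quot_nneg (R : realType) (H : completeNormedModType R)
    (f : R -> H) (t : R) :=
  (fun s : R => (s - t)^-1 *: (f s - f t)) @ within `[0, +oo[%classic t^'.

Definition derivable_nneg (R : realType) (H : completeNormedModType R)
    (f : R -> H) (t : R) : Prop := cvg (diff_quot_nneg f t).

Definition deriv_nneg (R : realType) (H : completeNormedModType R)
    (f : R -> H) (t : R) : H := lim (diff_quot_nneg f t).

Record strong_global_solution (R : realType) (H : completeNormedModType R)
    (A : H -> set H) (D B : H -> H) (gamma lambda beta : R -> R) (u0 v0 : H)
    (x : R -> H) : Prop := StrongGlobalSolution {
  sol_lac : locally_absolutely_continuous x ;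
  sol_derivable : forall t, 0 <= t -> derivable_nneg x t ;
  sol_deriv_lac : locally_absolutely_continuous (deriv_nneg x) ;
  sol_ode : {ae (@lebesgue_measure R), forall t, 0 <= t ->
    derivable_nneg (deriv_nneg x) t /\
    deriv_nneg (deriv_nneg x) t + gamma t *: deriv_nneg x t + x t =
      resolvent (lambda t) A
        (x t - lambda t *: D (x t) - (lambda t * beta t) *: B (x t))} ;
  sol_init : x 0 = u0 ;
  sol_deriv_init : deriv_nneg x 0 = v0
}.

(* Main.v *)
(* The resolvent is everywhere defined by Minty's theorem, and the resolvent
   inequality |J_l z - J_m w| <= |z - w| + |1 - l / m| |w - J_m w| makes the
   right-hand side Lipschitz in the state and continuous in time. Hence the
   equivalent first order system in H * H has a C^1 solution by Picard
   iteration. For uniqueness, the difference Z of two solutions is absolutely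
   continuous with |Z'| <= K |Z| almost everywhere, so a bound |Z| <= M e^(2Kt)
   improves itself to |Z| <= (M / 2) e^(2Kt).

   Minty's theorem is proved by maximizing the concave dual function
   -s - |(y - v) / 2|^2 over the convex hull of the points (y, v, <y, v>) of the
   graph: monotonicity makes it nonpositive, and by the parallelogram identity
   the points (y - v) / 2 of a maximizing sequence form a Cauchy sequence, whose
   limit is monotonically related to the graph.

   No vector-valued integral is needed: primitives are limits of Riemann sums,
   and estimates come from a mean value inequality proved by induction along
   the real line. *)

Require Import Defs.
From HB Require Import structures.
From mathcomp Require Import all_boot all_order all_algebra.
From mathcomp Require Import all_classical all_reals all_analysis.
From mathcomp Require Import ring lra.

Set Implicit Arguments.
Unset Strict Implicit.
Unset Printing Implicit Defensive.

Import Order.TTheory GRing.Theory Num.Theory.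
Import numFieldNormedType.Exports.

Local Open Scope classical_set_scope.
Local Open Scope ring_scope.

(** * Derivatives and mean value inequalities on the half-line *)

(** Let r be the supremum of the points of [0, b] satisfying [P]. The step at r carries [P] from
    just below r to beyond r, unless b is met first. A step across r merges the limit and successor
    cases. *)
Lemma real_induction (R : realType) (P : R -> Prop) (b : R) : 0 <= b -> P 0 ->
  (forall r : R, 0 <= r <= b -> exists2 d : R, 0 < d &
    forall s s' : R, 0 <= s -> s <= r -> r <= s' -> s' <= b -> s' - s < d ->
      P s -> P s') ->
  P b.
Proof.
move=> b0 P0 step; pose S := [set t | 0 <= t <= b /\ P t].
have supS : has_sup S.
  split; first by exists 0; split=> //; lra.
  by exists b => t [/andP[]].
have S_le t : S t -> t <= sup S by exact: ub_le_sup supS.2 t.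
have S0 : S 0 by split=> //; lra.
have rb : sup S <= b by apply: ge_sup supS.1 _ => t [/andP[]].
have r0 := S_le _ S0.
have rb0 : 0 <= sup S <= b by rewrite r0.
have [d d0 Pd] := step _ rb0.
have [s [/andP[s0 sb] Ps] ds] := sup_adherent (divr_gt0 d0 (ltr0n _ 2)) supS.
have sr : s <= sup S by apply: S_le; split=> //; lra.
(* s lies less than d / 2 below the supremum and s' at most d / 4 above it, so s' - s < d. *)
pose s' := Num.min b (sup S + d / 4).
have [s'b s'd] : s' <= b /\ s' <= sup S + d / 4.
  by rewrite !ge_min !lexx orbT.
have rs' : sup S <= s' by rewrite le_min rb /=; lra.
have Ps' : P s' by apply: (Pd s s') => //; lra.
have s'r : s' <= sup S by apply: S_le; split=> //; lra.
suff <- : s' = b by [].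
by move: s'r; rewrite /s'; case: (leP b (sup S + d / 4)) => // _ s'r; lra.
Qed.

Section HalfLine.
Context {R : realType} {V : completeNormedModType R}.
Implicit Types (f g : R -> V) (b e r s t : R).

Definition continuous_nneg f := forall t, 0 <= t -> forall e, 0 < e ->
  exists2 d, 0 < d &
    forall s, 0 <= s -> `|s - t| < d -> `|f s - f t| <= e.

(* Straddling the point t makes the estimate compatible with the induction of
   [real_induction], and one-sided at t = 0. *)
Definition straddle_deriv f t (v : V) := forall e, 0 < e ->
  exists2 d, 0 < d & forall s s', 0 <= s -> s <= t -> t <= s' -> s' - s < d ->
    `|f s' - f s - (s' - s) *: v| <= e * (s' - s).

(** Heine's theorem by real induction: when the interval grows across r, two close points that are
    not both in the old interval lie within d of r, where continuity at r applies. *)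
Lemma continuous_nneg_unif f b : continuous_nneg f -> 0 <= b ->
  forall e, 0 < e -> exists2 d, 0 < d & forall s t,
    0 <= s <= b -> 0 <= t <= b -> `|s - t| < d -> `|f s - f t| <= e.
Proof.
move=> cf b0 e e0.
apply: (@real_induction _ (fun c => exists2 d, 0 < d & forall s t,
  0 <= s <= c -> 0 <= t <= c -> `|s - t| < d -> `|f s - f t| <= e)) => //.
  exists 1 => // s t s0 t0 _.
  have [-> ->] : s = 0 /\ t = 0 by lra.
  by rewrite subrr normr0 ltW.
move=> r /andP[r0 rb]; have [d d0 fd] := cf r r0 (e / 2) ltac:(lra).
exists (d / 2); first lra.
move=> c c' c0 cr rc' c'b cd [d1 d10 fd1].
exists (Num.min d1 (d / 2)); first by rewrite lt_min d10 /=; lra.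
move=> s t /andP[s0 sc'] /andP[t0 tc']; rewrite lt_min => /andP[st1 st2].
have [sc|cs] := leP s c; have [tc|ct] := leP t c.
- by apply: fd1 => //; lra.
all: suff : `|f s - f r| <= e / 2 /\ `|f r - f t| <= e / 2
  by have := ler_distD (f r) (f s) (f t); lra.
all: rewrite (distrC (f r)).
all: split; apply: fd => //; move: st2; rewrite !ltr_norml; lra.
Qed.

Lemma continuous_nneg_bounded f b : continuous_nneg f -> 0 <= b ->
  exists2 M, 0 < M & forall t, 0 <= t <= b -> `|f t| <= M.
Proof.
move=> cf b0.
apply: (@real_induction _ (fun c =>
  exists2 M, 0 < M & forall t, 0 <= t <= c -> `|f t| <= M)) => //.
  exists (`|f 0| + 1); first by have := normr_ge0 (f 0); lra.
  move=> t t0; have -> : t = 0 by lra.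
  by rewrite lerDl.
move=> r /andP[r0 rb]; have [d d0 fd] := cf r r0 1 ltac:(lra).
exists d => // c c' c0 cr rc' c'b cd [M M0 fM].
exists (Num.max M (`|f r| + 1)); first by rewrite lt_max M0.
move=> t /andP[t0 tc']; rewrite le_max.
have [tc|ct] := leP t c; first by rewrite fM ?t0.
apply/orP; right; rewrite -(subrK (f r) (f t)).
apply: le_trans (ler_normD _ _) _.
by rewrite addrC lerD2l; apply: fd => //; rewrite ltr_norml; lra.
Qed.

(** The comparison with [phi] fails by at most e per unit of length, and real induction adds these
    errors up to e * b, with e arbitrary. *)
Lemma straddle_deriv_growth f (phi : R -> R) b : 0 <= b ->
  (forall r : R, 0 <= r <= b -> forall e : R, 0 < e -> exists2 d : R, 0 < d &
    forall s s' : R, 0 <= s -> s <= r -> r <= s' -> s' <= b -> s' - s < d ->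
      `|f s' - f s| <= phi s' - phi s + e * (s' - s)) ->
  `|f b - f 0| <= phi b - phi 0.
Proof.
move=> b0 fphi; apply/ler_addgt0Pr => e e0.
(* The denominator b + 1 allows b = 0. *)
pose e' := e / (b + 1); have e'0 : 0 < e' by rewrite divr_gt0//; lra.
have: `|f b - f 0| <= phi b - phi 0 + e' * b.
  apply: (@real_induction _ (fun t =>
    `|f t - f 0| <= phi t - phi 0 + e' * t)) => //.
    by rewrite !subrr normr0; lra.
  move=> r rb; have [d d0 fd] := fphi r rb e' e'0.
  exists d => // s s' s0 sr rs' s'b ss' /= IH.
  have := fd s s' s0 sr rs' s'b ss'.
  by have := ler_distD (f s) (f s') (f 0); lra.
move/le_trans; apply; rewrite lerD2l /e' -mulrA; apply: ler_piMr.
  exact: ltW.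
by rewrite mulrC ler_pdivrMr; lra.
Qed.

Lemma disjoint_itv_length (U : set R) n (l r : 'I_n -> R) :
  open U -> (forall k, l k <= r k) ->
  (forall k, `]l k, r k[%classic `<=` U) ->
  trivIset setT (fun k => `]l k, r k[%classic) ->
  ((\sum_(k < n) (r k - l k))%:E <= lebesgue_measure U)%E.
Proof.
move=> oU lr lrU tlr.
have itvE k : lebesgue_measure `]l k, r k[%classic = (r k - l k)%:E.
  rewrite lebesgue_measure_itv/= lte_fin; case: ltP => // rl.
  by congr EFin; have := lr k; lra.
have -> : (\sum_(k < n) (r k - l k))%:E =
    lebesgue_measure (\big[setU/set0]_(k < n) `]l k, r k[%classic).
  rewrite measure_bigsetU_ord// -sumEFin.
  by apply: eq_bigr => k _; exact/esym/itvE.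
apply: le_measure; rewrite ?inE.
- by apply: bigsetU_measurable.
- exact: measurable_realfun.open_measurable.
by rewrite -bigcup_seq => x [k _]; exact: lrU.
Qed.

(** Cover [E] by an open set of measure below the modulus of absolute continuity for e / 2. Steps
    across [E] then cost at most e / 2 in total, and [phi] does not decrease along them; the other
    steps cost at most e / 2 as in [straddle_deriv_growth]. *)
Lemma absolutely_continuous_growth f (phi : R -> R) (E : set R) b : 0 <= b ->
  absolutely_continuous_on 0 b f ->
  (forall s t : R, 0 <= s -> s <= t -> t <= b -> phi s <= phi t) ->
  lebesgue_measure.-negligible E ->
  (forall r : R, 0 <= r <= b -> ~ E r ->
    forall e : R, 0 < e -> exists2 d : R, 0 < d &
    forall s s' : R, 0 <= s -> s <= r -> r <= s' -> s' <= b -> s' - s < d ->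
      `|f s' - f s| <= phi s' - phi s + e * (s' - s)) ->
  `|f b - f 0| <= phi b - phi 0.
Proof.
move=> b0 acf phi_nd [N [mN N0 EN]] fphi; apply/ler_addgt0Pr => e e0.
have [d d0 acfd] := acf _ (divr_gt0 e0 (ltr0n _ 2)).
have [U [oU NU Ud]] : exists U : set R,
    [/\ open U, N `<=` U & (lebesgue_measure U < d%:E)%E].
  (* Outer regularity bounds the measure of [U] minus [N], which is that of [U] since [N] is
     null. *)
  have Noo : (lebesgue_measure N < +oo)%E by rewrite N0.
  have [U [oU NU Ud]] := lebesgue_regularity_outer mN Noo d0.
  exists U; split => //; apply: le_lt_trans Ud.
  have mU := measurable_realfun.open_measurable oU.
  rewrite (measureDI lebesgue_measure mU mN) setIidr//.
  by rewrite [X in (_ + X)%E](_ : _ = 0%E) ?adde0.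
pose e' := e / 2 / (b + 1).
have e'0 : 0 < e' by rewrite divr_gt0 ?divr_gt0//; lra.
have e'b : e' * b <= e / 2.
  rewrite /e' -mulrA; apply: ler_piMr; first lra.
  by rewrite mulrC ler_pdivrMr; lra.
(* Steps across points of E stay in U, and their increments are collected in
   finitely many disjoint intervals of total length less than d. *)
pose P t := exists n (l r : nat -> R),
  [/\ forall k, (k < n)%N ->
        [/\ 0 <= l k, l k <= r k, r k <= t & `]l k, r k[%classic `<=` U],
      forall i j, (i < j)%N -> (j < n)%N -> r i <= l j &
      `|f t - f 0| <= phi t - phi 0 + e' * t +
        \sum_(k < n) `|f (r k) - f (l k)|].
have [n [l [r [lrU lr_sorted fb]]]] : P b.
  apply: real_induction => //.
    exists 0%N, (fun=> 0), (fun=> 0); split=> //.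
    by rewrite big_ord0 !subrr normr0; lra.
  move=> r rb; have [Er|nEr] := pselect (E r).
    have /nbhs_ballP[d1 d10 rd1] : nbhs r U.
      by apply: open_nbhs_nbhs; split=> //; apply/NU/EN.
    exists d1 => // s s' s0 sr rs' s'b ss' [n [l [r1 [lrU lr_sorted fs]]]].
    exists n.+1, (fun k => if k == n then s else l k),
      (fun k => if k == n then s' else r1 k); split.
    - move=> k; rewrite ltnS leq_eqVlt; case: eqP => /= [_ _|_ kn].
        split=> //; first lra.
        move=> x /=; rewrite in_itv/= => /andP[sx xs'].
        by apply: rd1; rewrite /ball/= ltr_norml; lra.
      by have [? ? ? ?] := lrU k kn; split=> //; lra.
    - move=> i j ij jn; have i_n : (i < n)%N by exact: leq_trans ij jn.
      rewrite (ltn_eqF i_n); case: eqP => [_|/eqP jn']; last first.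
        by apply: lr_sorted => //; rewrite ltn_neqAle jn' -ltnS.
      by have [_ _ ris _] := lrU i i_n; lra.
    rewrite big_ord_recr/= eqxx.
    under eq_bigr => i _ do rewrite ltn_eqF//.
    have := phi_nd s s' s0 ltac:(lra) s'b.
    have := ler_distD (f s) (f s') (f 0).
    have : e' * s <= e' * s' by rewrite ler_pM2l//; lra.
    by move: fs; lra.
  have [d1 d10 fd1] := fphi r rb nEr e' e'0.
  exists d1 => // s s' s0 sr rs' s'b ss' [n [l [r1 [lrU lr_sorted fs]]]].
  exists n, l, r1; split => //.
    by move=> k kn; have [? ? ? ?] := lrU k kn; split=> //; lra.
  have := fd1 s s' s0 sr rs' s'b ss'.
  have := ler_distD (f s) (f s') (f 0).
  by move: fs; lra.
have tlr : trivIset setT (fun k : 'I_n => `]l k, r k[%classic).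
  move=> i j _ _ [x [/=]]; rewrite !in_itv/= => /andP[li ri] /andP[lj rj].
  case: (ltngtP (i : nat) (j : nat)) => [ij|ij|/ord_inj//].
    have := lt_trans (lt_le_trans ri (lr_sorted _ _ ij (ltn_ord j))) lj.
    by rewrite ltxx.
  have := lt_trans (lt_le_trans rj (lr_sorted _ _ ij (ltn_ord i))) li.
  by rewrite ltxx.
apply: le_trans fb _; suff : \sum_(k < n) `|f (r k) - f (l k)| <= e / 2 by lra.
apply/ltW/(acfd n l r) => //; first by move=> k; have [] := lrU k (ltn_ord k).
rewrite -lte_fin; apply: le_lt_trans Ud.
apply: disjoint_itv_length => //.
  by move=> k; have [] := lrU k (ltn_ord k).
by move=> k; have [] := lrU k (ltn_ord k).
Qed.

End HalfLine.

(** * Primitives of continuous functions *)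

Section Completeness.
Context {R : realType} {V : completeNormedModType R}.

Lemma cauchy_seq_lim (u : nat -> V) :
  (forall e : R, 0 < e -> exists N, forall m n, (N <= m)%N -> (N <= n)%N ->
    `|u m - u n| <= e) ->
  exists l : V, forall e : R, 0 < e -> exists N, forall n, (N <= n)%N ->
    `|u n - l| <= e.
Proof.
move=> cu; have : cvg (u @ \oo).
  apply/cauchy_cvgP/cauchy_exP => e e0.
  have [N uN] := cu _ (divr_gt0 e0 (ltr0n _ 2)).
  exists (u N), N => // n /= Nn; rewrite -ball_normE/=.
  by apply: le_lt_trans (uN _ _ (leqnn N) Nn) _; lra.
move=> /cvgrPdist_le ul; exists (lim (u @ \oo)) => e e0.
by have [N _ uN] := ul e e0; exists N => n Nn; rewrite distrC; exact: uN.
Qed.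

Lemma norm_le_eq (x y : V) : (forall e : R, 0 < e -> `|x - y| <= e) -> x = y.
Proof.
move=> xy; apply/subr0_eq/normr0_eq0/le_anti; rewrite normr_ge0 andbT.
by apply/ler_addgt0Pr => e e0; rewrite add0r xy.
Qed.

End Completeness.

Section Primitive.
Context {R : realType} {V : completeNormedModType R}.
Implicit Types (f g : R -> V) (b e r s t : R) (v : V).

Lemma straddle_derivB f g t v w : straddle_deriv f t v ->
  straddle_deriv g t w -> straddle_deriv (fun s => f s - g s) t (v - w).
Proof.
move=> fv gw e e0.
have [d1 d10 fd] := fv _ (divr_gt0 e0 (ltr0n _ 2)).
have [d2 d20 gd] := gw _ (divr_gt0 e0 (ltr0n _ 2)).
exists (Num.min d1 d2); first by rewrite lt_min d10.
move=> s s' s0 st ts'; rewrite lt_min => /andP[ss1 ss2].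
have := fd s s' s0 st ts' ss1; have := gd s s' s0 st ts' ss2.
have -> : f s' - g s' - (f s - g s) - (s' - s) *: (v - w) =
    (f s' - f s - (s' - s) *: v) - (g s' - g s - (s' - s) *: w).
  by rewrite scalerBr !opprD (addrACA (f s')) [LHS]addrACA.
have := ler_normB (f s' - f s - (s' - s) *: v) (g s' - g s - (s' - s) *: w).
lra.
Qed.

Lemma straddle_deriv_continuous f (f' : R -> V) :
  (forall t, 0 <= t -> straddle_deriv f t (f' t)) -> continuous_nneg f.
Proof.
move=> ff' t t0 e e0; have [d d0 fd] := ff' t t0 1 ltac:(lra).
have B0 : 0 < `|f' t| + 1 by have := normr_ge0 (f' t); lra.
have bound (s s' : R) : 0 <= s -> s <= t -> t <= s' -> s' - s < d ->
    `|f s' - f s| <= (`|f' t| + 1) * (s' - s).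
  move=> s0 st ts' ss'; have := fd s s' s0 st ts' ss'.
  have := ler_distD ((s' - s) *: f' t) (f s' - f s) 0.
  by rewrite !subr0 normrZ ger0_norm; lra.
exists (Num.min d (e / (`|f' t| + 1))).
  by rewrite lt_min d0 divr_gt0.
move=> s s0; rewrite lt_min ltr_pdivlMr// => /andP[std ste].
have [st|ts] := leP s t.
  rewrite distrC; rewrite distrC ger0_norm in std ste; last lra.
  by apply: le_trans (bound s t s0 st (lexx _) std) _; rewrite mulrC ltW.
rewrite ger0_norm in std ste; last lra.
by apply: le_trans (bound t s t0 (lexx _) (ltW ts) std) _; rewrite mulrC ltW.
Qed.

(* Mesh 1/(n+1) on [0, n+1]; the difference of the two minima is the length of
   the part of the k-th mesh interval that lies before t. *)
Definition riemann_sum g n t : V :=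
  \sum_(k < n.+1 ^ 2) (Num.min t (k.+1%:R / n.+1%:R) -
                       Num.min t (k%:R / n.+1%:R)) *: g (k%:R / n.+1%:R).

Lemma riemann_sum0 g n : riemann_sum g n 0 = 0.
Proof.
rewrite /riemann_sum big1// => k _.
by rewrite !min_l ?subrr ?scale0r// divr_ge0.
Qed.

(** The increment of the sum from s to t combines values of g at the nodes with nonnegative weights
    of total t - s. A nonzero weight requires a node that is at most t and at most one mesh before
    s. *)
Lemma riemann_sum_approx g n s t v e : 0 <= s -> s <= t -> t <= n.+1%:R ->
  (forall r, 0 <= r -> s - n.+1%:R^-1 <= r -> r <= t -> `|g r - v| <= e) ->
  `|riemann_sum g n t - riemann_sum g n s - (t - s) *: v| <= e * (t - s).
Proof.
move=> s0 st tn ge; pose x k : R := k%:R / n.+1%:R.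
have xS k : x k.+1 = x k + n.+1%:R^-1 by rewrite /x -natr1 mulrDl mul1r.
have h0 : 0 < n.+1%:R^-1 :> R by rewrite invr_gt0.
have x0 k : 0 <= x k by rewrite divr_ge0.
pose l t k := Num.min t (x k.+1) - Num.min t (x k).
pose w k := l t k - l s k.
(* The (n+1)^2 mesh intervals exactly cover [0, n+1]. *)
have lsum (u : R) : 0 <= u -> u <= n.+1%:R -> \sum_(k < n.+1 ^ 2) l u k = u.
  move=> u0 un; rewrite -(big_mkord xpredT (l u)) telescope_sumr//.
  rewrite /x mul0r (min_r u0) subr0 min_l// expnS expn1 natrM.
  by rewrite mulfK// pnatr_eq0.
have wsum : \sum_(k < n.+1 ^ 2) w k = t - s by rewrite sumrB !lsum//; lra.
have wP k : 0 <= w k /\ (w k = 0 \/ s - n.+1%:R^-1 <= x k /\ x k <= t).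
  have := xS k; rewrite /w /l; move: (x k.+1) (x k) h0 => y z.
  move: (n.+1%:R^-1) => h h0 yz.
  by case: (leP t y) => ty; case: (leP t z) => tz;
    case: (leP s y) => sy; case: (leP s z) => sz; split; lra.
have -> : riemann_sum g n t - riemann_sum g n s - (t - s) *: v =
    \sum_(k < n.+1 ^ 2) w k *: (g (x k) - v).
  rewrite -wsum scaler_suml /riemann_sum -!sumrB; apply: eq_bigr => k _.
  by rewrite scalerBr [in RHS]scalerBl.
rewrite -wsum mulr_sumr; apply: le_trans (ler_norm_sum _ _ _) _.
apply: ler_sum => k _; rewrite normrZ; have [wk0 [->|[sx xt]]] := wP k.
  by rewrite normr0 mul0r mulr0.
by rewrite ger0_norm// mulrC ler_wpM2r// ge.
Qed.

(** Two Riemann sums differ by a function with small increments, so the mean value inequality makes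
    them Cauchy at each point. The straddling estimate is uniform in n and passes to the limit. *)
Lemma primitive_exists g : continuous_nneg g ->
  exists2 G : R -> V, G 0 = 0 &
    forall t, 0 <= t -> straddle_deriv G t (g t).
Proof.
move=> cg.
have approx b e : 0 <= b -> 0 < e -> exists2 d, 0 < d & exists N,
    forall n r s t, (N <= n)%N -> 0 <= s -> s <= r -> r <= t -> t <= b ->
      t - s < d ->
    `|riemann_sum g n t - riemann_sum g n s - (t - s) *: g r| <= e * (t - s).
  move=> b0 e0; have [d d0 gd] := continuous_nneg_unif cg b0 e0.
  exists (d / 2); first lra.
  (* From this index on, the mesh reaches b and its size is below d / 2. *)
  exists (Num.bound (b + 2 / d)) => n r s t Nn s0 sr rt tb tsd.
  have d20 : 0 < 2 / d by rewrite divr_gt0.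
  have bn : b + 2 / d < n.+1%:R.
    apply: lt_le_trans (archi_boundP _) _; first lra.
    by rewrite ler_nat ltnW.
  have hd : n.+1%:R^-1 < d / 2.
    by rewrite -[d / 2]invrK invf_div ltf_pV2 ?posrE//; lra.
  apply: riemann_sum_approx => //; try lra.
  move=> u u0; move: (n.+1%:R^-1) hd => h hd su ut.
  by apply: gd; rewrite ?ltr_norml; lra.
have [G limG] : exists G : R -> V, forall t, 0 <= t -> forall e, 0 < e ->
    exists N, forall n, (N <= n)%N -> `|riemann_sum g n t - G t| <= e.
  suff /choice[G GP] : forall t, exists l : V, 0 <= t -> forall e, 0 < e ->
      exists N, forall n, (N <= n)%N -> `|riemann_sum g n t - l| <= e.
    by exists G.
  move=> b; have [b0|b0] := leP 0 b; last by exists 0.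
  suff [l lP] : exists l : V, forall e, 0 < e ->
      exists N, forall n, (N <= n)%N -> `|riemann_sum g n b - l| <= e.
    by exists l.
  apply: cauchy_seq_lim => e e0; pose e' := e / 2 / (b + 1).
  have e'0 : 0 < e' by rewrite !divr_gt0//; lra.
  have [d d0 [N RN]] := approx b e' b0 e'0.
  exists N => m n Nm Nn.
  (* Both sums follow [g r] up to e' per unit of length, so their difference grows at rate at most 2
     * e', and 2 * e' * b <= e. *)
  have := @straddle_deriv_growth _ _
    (fun t => riemann_sum g m t - riemann_sum g n t) (fun t => 2 * e' * t) b b0.
  rewrite !riemann_sum0 mulr0 !subr0 => /(_ _)/le_trans; apply; last first.
    have -> : 2 * e' * b = e * (b / (b + 1)) by rewrite /e'; field; lra.
    by rewrite ler_piMr ?(ltW e0)// ler_pdivrMr; lra.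
  move=> r rb e1 e10; exists d => // s s' s0 sr rs' s'b ss'.
  have := RN m r s s' Nm s0 sr rs' s'b ss'.
  have := RN n r s s' Nn s0 sr rs' s'b ss'.
  set p := riemann_sum g n s' - _ - _; set q := riemann_sum g m s' - _ - _.
  have -> : riemann_sum g m s' - riemann_sum g n s' -
      (riemann_sum g m s - riemann_sum g n s) = q - p.
    by rewrite /p /q [in RHS]opprB subrKA !opprD [LHS]addrACA.
  have := ler_normB q p.
  have : 0 <= e1 * (s' - s) by rewrite mulr_ge0; lra.
  lra.
exists G.
  apply: norm_le_eq => e e0; have [N GN] := limG 0 (lexx _) e e0.
  by rewrite distrC; have := GN N (leqnn N); rewrite riemann_sum0.
move=> t t0 e e0; have [d d0 [N RN]] := approx (t + 1) e ltac:(lra) e0.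
exists (Num.min d 1); first by rewrite lt_min d0 /=; lra.
move=> s s' s0 st ts'; rewrite lt_min => /andP[ssd ss1].
(* The slack e1 pays for replacing [G] by the n-th sum at s and at s'. *)
apply/ler_addgt0Pr => e1 e10.
have [N1 G1] := limG s s0 _ (divr_gt0 e10 (ltr0n _ 2)).
have s'0 : 0 <= s' by lra.
have [N2 G2] := limG s' s'0 _ (divr_gt0 e10 (ltr0n _ 2)).
pose n := maxn N (maxn N1 N2).
have [nN n1 n2] : [/\ (N <= n)%N, (N1 <= n)%N & (N2 <= n)%N].
  by rewrite /n !leq_max !leqnn !orbT.
have {}G1 := G1 n n1; have {}G2 := G2 n n2.
have s't1 : s' <= t + 1 by lra.
have {RN nN} := RN n t s s' nN s0 st ts' s't1 ssd.
set p := riemann_sum g n s' - _ - _.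
have -> : G s' - G s - (s' - s) *: g t =
    p - (riemann_sum g n s' - G s') + (riemann_sum g n s - G s).
  rewrite /p; move: (_ *: _) (riemann_sum g n s) (riemann_sum g n s').
  move=> y a a'; rewrite opprB (addrC (a' - a - y)) -(addrA a') subrKA.
  by rewrite -[RHS]addrA (addrC (- a)) subrKA [RHS]addrA [RHS]addrAC.
have := ler_normD (p - (riemann_sum g n s' - G s')) (riemann_sum g n s - G s).
have := ler_normB p (riemann_sum g n s' - G s').
clear n1 n2; lra.
Qed.

End Primitive.

(** * The Cauchy-Lipschitz theorem *)

Section ExpGrowth.
Context {R : realType}.

(** By 1 + x <= exp x, the increment is at least c exp(cs) (s' - s). The same inequality between r
    and s bounds the loss from replacing exp(cs) by exp(cr), which is quadratic in s' - s. *)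
Lemma expR_straddle (c r e : R) : 0 < c -> 0 < e -> exists2 d : R, 0 < d &
  forall s s', s <= r -> r <= s' -> s' - s < d ->
    c * expR (c * r) * (s' - s) <=
    expR (c * s') - expR (c * s) + e * (s' - s).
Proof.
move=> c0 e0; have E0 := expR_gt0 (c * r).
have K0 : 0 < c * c * expR (c * r) by rewrite !mulr_gt0.
exists (e / (c * c * expR (c * r))); first by rewrite divr_gt0.
move=> s s' sr rs'; rewrite ltr_pdivlMr// => ssd.
have hs : expR (c * r) * (1 - c * (r - s)) <= expR (c * s).
  have -> : c * s = c * r + - (c * (r - s)) by ring.
  by rewrite expRD ler_pM2l// expR_ge1Dx.
have hs' : expR (c * s) * (1 + c * (s' - s)) <= expR (c * s').
  have -> : c * s' = c * s + c * (s' - s) by ring.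
  by rewrite expRD ler_pM2l ?expR_gt0// expR_ge1Dx.
have w0 : 0 <= c * (s' - s) by rewrite mulr_ge0; lra.
have := ler_wpM2r w0 hs.
have : (r - s) * (c * c * expR (c * r)) <= e.
  by apply: le_trans (ltW ssd); rewrite ler_pM2r; lra.
move=> /(ler_wpM2r (_ : 0 <= s' - s)) -/(_ ltac:(lra)).
nra.
Qed.

(** Supplies the hypothesis of the mean value inequalities for phi(t) = M exp(ct), whose derivative
    at r dominates |v|. *)
Lemma straddle_deriv_exp_growth (V : completeNormedModType R) (f : R -> V)
    (v : V) (r M c : R) :
  0 < c -> 0 <= M -> straddle_deriv f r v -> `|v| <= M * (c * expR (c * r)) ->
  forall e : R, 0 < e -> exists2 d : R, 0 < d &
    forall s s' : R, 0 <= s -> s <= r -> r <= s' -> s' - s < d ->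
    `|f s' - f s| <= M * expR (c * s') - M * expR (c * s) + e * (s' - s).
Proof.
move=> c0 M0 fv vM e e0.
have M1 : 0 < M + 1 by lra.
have [d1 d10 fd] := fv _ (divr_gt0 e0 (ltr0n _ 2)).
have e20 : 0 < e / 2 / (M + 1) by rewrite !divr_gt0.
have [d2 d20 expd] := expR_straddle r c0 e20.
exists (Num.min d1 d2); first by rewrite lt_min d10.
move=> s s' s0 sr rs'; rewrite lt_min => /andP[ss1 ss2].
have ss0 : 0 <= s' - s by lra.
have := ler_distD ((s' - s) *: v) (f s' - f s) 0.
rewrite !subr0 normrZ ger0_norm// => fss.
have := fd s s' s0 sr rs' ss1.
have := ler_wpM2l M0 (expd s s' sr rs' ss2).
have := ler_wpM2r ss0 vM.
have : M * (e / 2 / (M + 1) * (s' - s)) <= e / 2 * (s' - s).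
  rewrite mulrA ler_wpM2r//.
  rewrite [_ / (M + 1)]mulrC mulrA ler_piMl//; first lra.
  by rewrite ler_pdivrMr; lra.
lra.
Qed.

Lemma geometric_small (A e : R) : 0 < e -> exists n, A / 2 ^+ n <= e.
Proof.
move=> e0; exists (Num.bound (`|A| / e)).
rewrite ler_pdivrMr ?exprn_gt0// mulrC -ler_pdivrMr//.
have Ae : A / e <= `|A| / e by rewrite ler_pM2r ?invr_gt0// ler_norm.
apply: le_trans Ae _; apply: ltW; apply: lt_trans (archi_boundP _) _.
  by rewrite divr_ge0// ltW.
by rewrite -natrX ltr_nat ltn_expl.
Qed.

End ExpGrowth.

Section CauchyLipschitz.
Context {R : realType} {V : completeNormedModType R}.
Variables (F : R -> V -> V) (x0 : V).
Hypothesis F_lip : forall b : R, 0 <= b -> exists2 K, 0 < K &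
  forall t, 0 <= t <= b -> forall x y, `|F t x - F t y| <= K * `|x - y|.
Hypothesis F_cont : forall x, continuous_nneg (F ^~ x).

Lemma lipschitz_comp_continuous (X : R -> V) : continuous_nneg X ->
  continuous_nneg (fun t => F t (X t)).
Proof.
move=> cX t t0 e e0; have [K K0 FK] := F_lip (ler_wpDr ler01 t0).
have [d1 d10 Xd] := cX t t0 (e / 2 / K) (divr_gt0 (divr_gt0 e0 (ltr0n _ 2)) K0).
have [d2 d20 Fd] := F_cont (X t) t0 (divr_gt0 e0 (ltr0n _ 2)).
exists (Num.min 1 (Num.min d1 d2)).
  by rewrite !lt_min d10 d20 ltr01.
move=> s s0; rewrite !lt_min => /and3P[s1 sd1 sd2].
have sb : 0 <= s <= t + 1 by move: s1; rewrite ltr_norml; lra.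
have := FK s sb (X s) (X t).
have := Fd s s0 sd2.
have := ler_distD (F s (X t)) (F s (X s)) (F t (X t)).
have := Xd s s0 sd1; rewrite ler_pdivlMr// mulrC.
lra.
Qed.

(** Measured against the weight exp(2Kt), each Picard step halves the distance on the whole of
    [0, b], so no local solutions have to be glued. *)
Theorem cauchy_lipschitz : exists2 X : R -> V, X 0 = x0 &
  forall t, 0 <= t -> straddle_deriv X t (F t (X t)).
Proof.
(* [choice] asks for a value at every X, so a discontinuous X gets a dummy one; all iterates are
   continuous. *)
have /choice[Pic PicP] : forall X : R -> V, exists Y : R -> V,
    continuous_nneg X ->
    Y 0 = x0 /\ forall t, 0 <= t -> straddle_deriv Y t (F t (X t)).
  move=> X; have [cX|ncX] := pselect (continuous_nneg X); last by exists X.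
  have [G G0 dG] := primitive_exists (lipschitz_comp_continuous cX).
  exists (fun t => G t + x0) => _.
  split=> [|t t0 e e0]; first by rewrite G0 add0r.
  have [d d0 Gd] := dG t t0 e e0; exists d => // s s' s0 st ts' ssd.
  by rewrite opprD addrACA subrr addr0; exact: Gd.
pose X n := iter n Pic (fun=> x0).
have cX n : continuous_nneg (X n).
  elim: n => [|n /PicP[_ IHn]]; last exact: straddle_deriv_continuous IHn.
  by move=> t t0 e e0; exists 1 => // s s0 _; rewrite subrr normr0 ltW.
have X0 n : X n 0 = x0.
  by case: n => [//|n]; have [] := PicP _ (cX n).
have dX n t : 0 <= t -> straddle_deriv (X n.+1) t (F t (X n t)).
  by have [_] := PicP _ (cX n); exact.
have Cauchy b : 0 <= b -> exists A, forall n k t, 0 <= t <= b ->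
    `|X (n + k)%N t - X n t| <= A / 2 ^+ n.
  move=> b0; have [K K0 FK] := F_lip b0; pose c := 2 * K.
  have c0 : 0 < c by rewrite mulr_gt0.
  have [M0 M00 XM0] := continuous_nneg_bounded (cX 0%N) b0.
  have [M1 M10 XM1] := continuous_nneg_bounded (cX 1%N) b0.
  pose C := M0 + M1.
  (* Since c = 2 * K, the bound K (C / 2^n) exp(ct) on the derivative of the next difference is the
     derivative of (C / 2^(n+1)) exp(ct). *)
  have step n t : 0 <= t <= b ->
      `|X n.+1 t - X n t| <= C / 2 ^+ n * expR (c * t).
    elim: n t => [|n IHn] t tb.
      have := XM0 t tb; have := XM1 t tb; have := ler_normB (X 1%N t) (X 0%N t).
      have := expR_ge1Dx (c * t).
      have : 0 <= c * t by rewrite mulr_ge0; lra.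
      rewrite expr0 divr1 /C; nra.
    have Cn0 : 0 <= C / 2 ^+ n.+1 by rewrite divr_ge0 ?exprn_ge0// /C; lra.
    have t0 : 0 <= t by lra.
    have := @straddle_deriv_growth _ _ (fun s => X n.+2 s - X n.+1 s)
      (fun s => C / 2 ^+ n.+1 * expR (c * s)) t t0.
    rewrite !X0 !subrr subr0 mulr0 expR0 mulr1 => /(_ _)/le_trans; apply.
      move=> r rt e e0.
      have dXr := straddle_derivB (dX n.+1 r ltac:(lra)) (dX n r ltac:(lra)).
      have vb : `|F r (X n.+1 r) - F r (X n r)| <=
          C / 2 ^+ n.+1 * (c * expR (c * r)).
        apply: le_trans (FK r ltac:(lra) _ _) _.
        have -> : C / 2 ^+ n.+1 * (c * expR (c * r)) =
            K * (C / 2 ^+ n * expR (c * r)).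
          rewrite /c exprS; field.
          by rewrite expf_neq0.
        by rewrite ler_pM2l// IHn//; lra.
      have [d d0 Xd] := straddle_deriv_exp_growth c0 Cn0 dXr vb e0.
      by exists d => // s s' s0 sr rs' s't; exact: Xd.
    by rewrite gerBl.
  pose A := C * expR (c * b).
  have stepA n t : 0 <= t <= b -> `|X n.+1 t - X n t| <= A / 2 ^+ n.
    move=> tb; apply: le_trans (step n t tb) _; rewrite mulrAC.
    rewrite ler_pM2r ?invr_gt0 ?exprn_gt0// ler_pM2l; last by rewrite /C; lra.
    by rewrite ler_expR ler_pM2l//; lra.
  have A0 : 0 <= A by rewrite mulr_ge0 ?expR_ge0// /C; lra.
  exists (2 * A) => n k t tb.
  (* The subtracted term makes the geometric series telescope in k. *)
  suff : `|X (n + k)%N t - X n t| <= 2 * A / 2 ^+ n - 2 * A / 2 ^+ (n + k).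
    have : 0 <= 2 * A / 2 ^+ (n + k) by rewrite divr_ge0 ?exprn_ge0//; lra.
    lra.
  elim: k => [|k IHk]; first by rewrite addn0 !subrr normr0.
  have := stepA (n + k)%N t tb.
  have := ler_distD (X (n + k)%N t) (X (n + k).+1 t) (X n t).
  have : A / 2 ^+ (n + k) = 2 * A / 2 ^+ (n + k).+1.
    by rewrite exprS; field; rewrite expf_neq0.
  by rewrite addnS; lra.
have [Xl XlP] : exists Xl : R -> V, forall b, 0 <= b -> exists A,
    forall n t, 0 <= t <= b -> `|X n t - Xl t| <= A / 2 ^+ n.
  have /choice[Xl XlP] : forall t, exists l, 0 <= t -> forall e, 0 < e ->
      exists N, forall n, (N <= n)%N -> `|X n t - l| <= e.
    move=> t; have [t0|t0] := leP 0 t; last by exists 0.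
    have [A XA] := Cauchy t t0.
    suff [l lP] : exists l : V, forall e, 0 < e ->
      exists N, forall n, (N <= n)%N -> `|X n t - l| <= e by exists l.
    apply: cauchy_seq_lim => e e0.
    have [N AN] := geometric_small A (divr_gt0 e0 (ltr0n _ 2)).
    exists N => m n Nm Nn.
    have := XA N (m - N)%N t ltac:(lra); have := XA N (n - N)%N t ltac:(lra).
    rewrite !subnKC//; have := ler_distD (X N t) (X m t) (X n t).
    by rewrite (distrC (X N t)); clear Nm Nn; lra.
  exists Xl => b b0; have [A XA] := Cauchy b b0; exists A => n t tb.
  apply/ler_addgt0Pr => e e0; have [N XN] := XlP t ltac:(lra) e e0.
  have := XN (n + N)%N (leq_addl _ _); have := XA n N t tb.
  have := ler_distD (X (n + N)%N t) (X n t) (Xl t).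
  by rewrite (distrC (X n t) (X (n + N)%N t)); lra.
have cXl : continuous_nneg Xl.
  move=> t t0 e e0; have [A XA] := XlP (t + 1) ltac:(lra).
  have [n An] := geometric_small A (divr_gt0 e0 (ltr0n _ 3)).
  have [d d0 Xd] := cX n t t0 _ (divr_gt0 e0 (ltr0n _ 3)).
  exists (Num.min 1 d); first by rewrite lt_min ltr01.
  move=> s s0; rewrite lt_min => /andP[st1 std].
  have sb : 0 <= s <= t + 1 by move: st1; rewrite ltr_norml; lra.
  have := XA n s sb; have := XA n t ltac:(lra); have := Xd s s0 std.
  have := ler_distD (X n s) (Xl s) (Xl t).
  have := ler_distD (X n t) (X n s) (Xl t).
  by rewrite (distrC (Xl s) (X n s)); lra.
have [Y0 dY] := PicP _ cXl.
have XlY t : 0 <= t -> Xl t = Pic Xl t.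
  move=> t0; have [A XA] := XlP t t0; have [K K0 FK] := F_lip t0.
  apply: norm_le_eq => e e0.
  (* K * t times A / 2^n bounds the distance from [X n.+1] to [Pic Xl], and one more A / 2^n that
     from [X n.+1] to [Xl]. *)
  have [n An] := geometric_small (A * (K * t + 1)) e0.
  have step : `|X n.+1 t - Pic Xl t| <= K * (A / 2 ^+ n) * t.
    have := @straddle_deriv_growth _ _ (fun s => X n.+1 s - Pic Xl s)
      (fun s => K * (A / 2 ^+ n) * s) t t0.
    rewrite X0 Y0 subrr subr0 mulr0 subr0; apply.
    move=> r rt e1 e10; have r0 : 0 <= r by lra.
    have [d d0 Xd] := straddle_derivB (dX n r r0) (dY r r0) e10.
    exists d => // s s' s0 sr rs' s't ssd.
    have := Xd s s' s0 sr rs' ssd.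
    have ss0 : 0 <= s' - s by lra.
    have := ler_distD ((s' - s) *: (F r (X n r) - F r (Xl r)))
      (X n.+1 s' - Pic Xl s' - (X n.+1 s - Pic Xl s)) 0.
    rewrite !subr0 normrZ (ger0_norm ss0).
    have : `|F r (X n r) - F r (Xl r)| <= K * (A / 2 ^+ n).
      apply: le_trans (FK r rt _ _) _; rewrite ler_pM2l//.
      by apply: XA.
    by move=> /(ler_wpM2l ss0); lra.
  have := XA n.+1 t ltac:(lra).
  have := ler_distD (X n.+1 t) (Xl t) (Pic Xl t).
  rewrite (distrC (Xl t) (X n.+1 t)).
  have A0 : 0 <= A / 2 ^+ n by apply: le_trans (XA n t ltac:(lra)).
  have : A / 2 ^+ n.+1 <= A / 2 ^+ n.
    rewrite exprS invfM mulrCA ler_piMl//; lra.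
  lra.
(* [Pic Xl] has derivative [F t (Xl t)] by construction and agrees with [Xl] on the half-line. *)
exists (Pic Xl) => // t t0; rewrite -XlY//; exact: dY.
Qed.

End CauchyLipschitz.

(** * Minty's theorem and resolvents *)

Section Hilbert.
Context {R : realType} {H : completeNormedModType R}.
Variable inner : {dot H for idfun}.
Hypothesis Hhilbert : hilbert_norm inner.
Implicit Types (x y z u v p q : H).

Lemma innerC x y : inner x y = inner y x.
Proof. by rewrite hermC /= expr0 mul1r. Qed.

Lemma innerDl x y z : inner (x + y) z = inner x z + inner y z.
Proof. by rewrite linearDl. Qed.

Lemma innerNl x z : inner (- x) z = - inner x z.
Proof. by rewrite linearNl. Qed.

Lemma innerZl (a : R) x z : inner (a *: x) z = a * inner x z.
Proof. by rewrite linearZl_LR. Qed.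

Lemma inner0l x : inner 0 x = 0.
Proof. by rewrite linear0l. Qed.

Lemma innerDr x y z : inner z (x + y) = inner z x + inner z y.
Proof. by rewrite innerC innerDl !(innerC z). Qed.

Lemma innerNr x z : inner z (- x) = - inner z x.
Proof. by rewrite innerC innerNl innerC. Qed.

Lemma innerZr (a : R) x z : inner z (a *: x) = a * inner z x.
Proof. by rewrite innerC innerZl innerC. Qed.

Definition innerE :=
  (innerDl, innerDr, innerNl, innerNr, innerZl, innerZr).

Lemma inner_ge0 x : 0 <= inner x x.
Proof.
have [->|/neq0_dnorm_gt0/ltW//] := eqVneq x 0.
by rewrite inner0l.
Qed.

Lemma inner_normE x : inner x x = `|x| ^+ 2.
Proof. by rewrite Hhilbert sqr_sqrtr// inner_ge0. Qed.

Lemma cauchy_schwarz x y : inner x y <= `|x| * `|y|.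
Proof.
have := inner_ge0 (`|y| *: x - `|x| *: y).
rewrite !innerE (innerC y x) !inner_normE.
have [->|x0] := eqVneq x 0.
  by rewrite inner0l normr0 mul0r.
have [->|y0] := eqVneq y 0.
  by rewrite innerC inner0l normr0 mulr0.
have n0 : 0 < `|x| * `|y| by rewrite mulr_gt0 ?normr_gt0.
move=> xy; rewrite -(ler_pM2l n0).
by move: xy; nra.
Qed.

(** Closure under binary combinations yields the hull without families of weights. The third
    coordinate is carried along because the first two do not determine it. *)
Inductive convex_hull_graph (G : H -> H -> Prop) : H -> H -> R -> Prop :=
| hull_graph y v : G y v -> convex_hull_graph G y v (inner y v)
| hull_convex (a : R) y v s y' v' s' : 0 <= a <= 1 ->
    convex_hull_graph G y v s -> convex_hull_graph G y' v' s' ->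
    convex_hull_graph G (a *: y + (1 - a) *: y') (a *: v + (1 - a) *: v')
      (a * s + (1 - a) * s').

(** The expression is affine in each of the two points separately, so it suffices to check it on the
    graph, where it equals <y - y', v - v'>. *)
Lemma convex_hull_graph_monotone (G : H -> H -> Prop) y v s y' v' s' :
  (forall y v y' v', G y v -> G y' v' -> 0 <= inner (y - y') (v - v')) ->
  convex_hull_graph G y v s -> convex_hull_graph G y' v' s' ->
  0 <= s + s' - inner y v' - inner y' v.
Proof.
move=> mono hull; elim: hull y' v' s' => {y v s}.
  move=> y v Gyv y' v' s' hull'; elim: hull' => {y' v' s'}.
    move=> y' v' Gy'v'; have := mono _ _ _ _ Gyv Gy'v'.
    by rewrite !innerE; lra.
  move=> a y1 v1 s1 y2 v2 s2 /andP[a0 a1] _ h1 _ h2; rewrite !innerE.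
  have a1' : 0 <= 1 - a by lra.
  by have := mulr_ge0 a0 h1; have := mulr_ge0 a1' h2; lra.
move=> a y1 v1 s1 y2 v2 s2 /andP[a0 a1] _ h1 _ h2 y' v' s' hull'.
have a1' : 0 <= 1 - a by lra.
have := mulr_ge0 a0 (h1 _ _ _ hull'); have := mulr_ge0 a1' (h2 _ _ _ hull').
by rewrite !innerE; lra.
Qed.

(** The inequality says that (p, -p) is monotonically related to [G]. It is first-order optimality
    at p along the segment towards a point of the graph, combined with the dual supremum being
    nonpositive. *)
Lemma monotone_extension (G : H -> H -> Prop) :
  (forall y v y' v', G y v -> G y' v' -> 0 <= inner (y - y') (v - v')) ->
  exists p, forall y v, G y v -> 0 <= inner (y - p) (v + p).
Proof.
move=> mono; have [[[y0 v0] /= Gy0]|] := pselect (exists k, G k.1 k.2);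
  last first.
  by move=> noG; exists 0 => y v Gyv; case: noG; exists (y, v).
pose Q (k : H * R) := exists y v, k.1 = 2^-1 *: (y - v) /\
  convex_hull_graph G y v k.2.
pose dual (k : H * R) := - k.2 - inner k.1 k.1.
have Q_convex (a : R) k k' : 0 <= a <= 1 -> Q k -> Q k' ->
    Q (a *: k.1 + (1 - a) *: k'.1, a * k.2 + (1 - a) * k'.2).
  move=> a01 [y [v [kE hull]]] [y' [v' [k'E hull']]].
  exists (a *: y + (1 - a) *: y'), (a *: v + (1 - a) *: v'); split => /=.
    rewrite kE k'E !scalerA ![_ * 2^-1]mulrC -!scalerA -scalerDr; congr (_ *: _).
    by rewrite !scalerBr opprD addrACA.
  exact: hull_convex.
(* The hull inequality at a single point gives s >= <y, v>, and <y, v> + |(y - v) / 2|^2 = |(y + v)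
   / 2|^2. *)
have dual_le0 k : Q k -> dual k <= 0.
  move=> [y [v [kE hull]]]; rewrite /dual kE !innerE.
  have := convex_hull_graph_monotone mono hull hull.
  have := inner_ge0 (y + v).
  by rewrite !innerE (innerC v y); lra.
pose D := [set dual k | k in Q].
have Qgen y v : G y v -> Q (2^-1 *: (y - v), inner y v).
  by move=> Gyv; exists y, v; split => //; exact: hull_graph.
have supD : has_sup D.
  split; first by eexists; exists (2^-1 *: (y0 - v0), inner y0 v0);
    [exact: Qgen|].
  by exists 0 => _ [k Qk <-]; exact: dual_le0.
set S := sup D.
have dual_leS k : Q k -> dual k <= S.
  by move=> Qk; apply: ub_le_sup supD.2 _ _; exists k.
have [u uP] : exists u : nat -> H * R,
    forall n, Q (u n) /\ S - n.+1%:R^-1 < dual (u n).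
  suff /choice[u uP] : forall n : nat, exists k,
      Q k /\ S - n.+1%:R^-1 < dual k by exists u.
  move=> n; have n0 : 0 < n.+1%:R^-1 :> R by rewrite invr_gt0.
  by have [_ [k Qk <-] Sk] := sup_adherent n0 supD; exists k.
have u_dual e : 0 < e -> exists N, forall n, (N <= n)%N -> S - e <= dual (u n).
  move=> e0; exists (Num.bound e^-1) => n Nn; have [_ /ltW] := uP n.
  apply: le_trans; rewrite lerD2l lerN2 -[leRHS]invrK lef_pV2 ?posrE ?invr_gt0//.
  apply: ltW; apply: lt_le_trans (archi_boundP _) _.
    by rewrite invr_ge0 ltW.
  by rewrite ler_nat ltnW.
have [p pP] : exists p, forall e : R, 0 < e -> exists N, forall n, (N <= n)%N ->
    `|(u n).1 - p| <= e.
  apply: cauchy_seq_lim => e e0.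
  (* The dual value at a midpoint exceeds the mean of the two dual values by a quarter of the
     squared distance. If both are within e^2 / 4 of the supremum, the distance is at most e. *)
  have e20 : 0 < e ^+ 2 / 4 by rewrite divr_gt0// exprn_gt0.
  have [N uN] := u_dual _ e20; exists N => m n Nm Nn.
  have := dual_leS _ (Q_convex 2^-1 _ _ ltac:(lra) (uP m).1 (uP n).1).
  have := uN m Nm; have := uN n Nn.
  rewrite -(@ler_sqr _ `|_|) ?nnegrE ?(ltW e0)// -inner_normE.
  rewrite /dual /= !innerE (innerC (u n).1 (u m).1).
  by clear; lra.
exists p => y v Gyv; pose c : H := 2^-1 *: (y - v).
have -> : inner (y - p) (v + p) = inner y v + 2 * inner c p - inner p p.
  by rewrite !innerE (innerC v p); lra.
apply/ler_addgt0Pr => e e0.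
(* W bounds |c - x| once |x - p| <= 1. The error e splits into thirds: near-maximality divided by t,
   the quadratic term t * W^2, and the replacement of x by p. *)
pose W := `|c - p| + 1.
have W0 : 0 < W by have := normr_ge0 (c - p); rewrite /W; lra.
pose t := e / (3 * W ^+ 2 + e).
have W20 : 0 < W ^+ 2 by rewrite exprn_gt0.
have t0 : 0 < t by rewrite divr_gt0//; lra.
have t1 : t <= 1 by rewrite ler_pdivrMr; lra.
have tW : t * W ^+ 2 <= e / 3.
  rewrite /t mulrAC ler_pdivrMr; last lra.
  by have := mulr_gt0 e0 e0; lra.
have te0 : 0 < t * (e / 3) by rewrite mulr_gt0// divr_gt0.
have eW0 : 0 < e / (6 * W) by rewrite divr_gt0//; lra.
have [N1 N1P] := u_dual _ te0.
have eW10 : 0 < Num.min 1 (e / (6 * W)) by rewrite lt_min ltr01.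
have [N2 N2P] := pP _ eW10.
pose n := maxn N1 N2.
have := N2P n (leq_maxr _ _); rewrite le_min => /andP[xp1 xpe].
have un := N1P n (leq_maxl _ _).
have d0 := dual_le0 _ (uP n).1.
(* Moving from [u n] with weight t towards the graph point cannot raise the dual value above S. *)
have := dual_leS _ (Q_convex t _ _ ltac:(lra) (Qgen y v Gyv) (uP n).1).
rewrite /dual /= -/c; move: un d0 xp1 xpe; rewrite /dual.
case: (u n) => x s /= un d0 xp1 xpe; clearbody c.
have cx : inner (c - x) (c - x) <= W ^+ 2.
  rewrite inner_normE ler_sqr ?nnegrE ?(ltW W0)//.
  by have := ler_distD p c x; rewrite (distrC p x) /W; lra.
have xpW : inner (2 *: (c - p) - (x - p)) (x - p) <= e / 3.
  apply: le_trans (cauchy_schwarz _ _) _.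
  have -> : e / 3 = 2 * W * (e / (6 * W)) by field; lra.
  apply: ler_pM => //.
  apply: le_trans (ler_normB _ _) _; rewrite normrZ ger0_norm// /W.
  by have := normr_ge0 (c - p); lra.
have := ler_wpM2l (ltW t0) cx.
move: cx xpW; rewrite !innerE (innerC c x) (innerC p x).
move=> cx xpW tcx tS.
have : 0 <= t * (inner y v + 2 * inner x c - inner x x + e / 3 + e / 3).
  have := ler_wpM2l (ltW t0) tW.
  have := ler_wpM2l (ltW t0) d0.
  have := ler_wpM2l (ltW t0) tcx.
  by move: tS un; clear; lra.
rewrite pmulr_rge0//.
by move: xpW; clear; lra.
Qed.

(** Apply [monotone_extension] to the graph of alpha A - x: the pair (p, -p) there corresponds to
    (p, (x - p) / alpha), which is monotonically related to A and belongs to it by maximality. *)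
Lemma maximally_monotone_resolvent_graph (A : H -> set H) (alpha : R) x :
  maximally_monotone inner A -> 0 < alpha ->
  exists p, A p (alpha^-1 *: (x - p)).
Proof.
move=> [monoA maxA] alpha0.
have [|p pP] := @monotone_extension (fun y v => A y (alpha^-1 *: (v + x))).
  move=> y v y' v' Ay Ay'; have := monoA _ _ _ _ Ay Ay'.
  rewrite -scalerBr opprD addrACA subrr addr0 innerZr.
  by rewrite pmulr_rge0// invr_gt0.
exists p; pose A' y := A y `|` [set v | y = p /\ v = alpha^-1 *: (x - p)].
suff <- : A' = A by right.
have Ap y v : A y v -> 0 <= inner (y - p) (v - alpha^-1 *: (x - p)).
  move=> Ayv; have := pP y (alpha *: v - x).
  rewrite subrK scalerA mulVf ?gt_eqF// scale1r => /(_ Ayv).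
  rewrite -(@pmulr_rge0 _ alpha^-1) ?invr_gt0// -innerZr -addrA scalerDr.
  by rewrite scalerA mulVf ?gt_eqF// scale1r (addrC (- x)) -scalerN opprB.
apply: maxA => [y y' v v' [Ay|[-> ->]] [Ay'|[-> ->]]|y v Ay]; last by left.
- exact: monoA.
- exact: Ap.
- by rewrite -(opprB y') -(opprB v') innerNl innerNr opprK Ap.
- by rewrite subrr inner0l.
Qed.

Lemma resolventP (A : H -> set H) (alpha : R) x :
  maximally_monotone inner A -> 0 < alpha ->
  A (resolvent alpha A x) (alpha^-1 *: (x - resolvent alpha A x)).
Proof.
move=> mA alpha0; have [p Ap] := maximally_monotone_resolvent_graph x mA alpha0.
have /xgetPex : resolvent_graph alpha A x !=set0.
  exists p; exists (alpha^-1 *: (x - p)) => //.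
  by rewrite scalerA divff ?gt_eqF// scale1r addrC subrK.
move=> /(_ 0)[a Aa]; rewrite -/(resolvent alpha A x) => xE.
rewrite -{2}xE addrAC subrr add0r scalerA mulVf ?gt_eqF// scale1r.
exact: Aa.
Qed.

(** Monotonicity of A at the two resolvent points, multiplied by l, bounds |p - q|^2 by an inner
    product with p - q, and Cauchy-Schwarz allows division by |p - q|. Equal parameters give
    nonexpansiveness, different ones continuity in time. *)
Lemma resolvent_dist (A : H -> set H) (l m : R) z w :
  maximally_monotone inner A -> 0 < l -> 0 < m ->
  `|resolvent l A z - resolvent m A w| <=
    `|z - w| + `|1 - l / m| * `|w - resolvent m A w|.
Proof.
move=> mA l0 m0; have := mA.1 _ _ _ _ (resolventP z mA l0) (resolventP w mA m0).
set p := resolvent l A z; set q := resolvent m A w => mono.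
have {mono} : inner (p - q) (p - q) <=
    inner (p - q) ((z - w) + (1 - l / m) *: (w - q)).
  rewrite -subr_ge0 -innerNr -innerDr.
  rewrite -(pmulr_rge0 _ l0) -innerZr in mono.
  suff <- : l *: (l^-1 *: (z - p) - m^-1 *: (w - q)) =
    z - w + (1 - l / m) *: (w - q) - (p - q) by [].
  rewrite scalerBr !scalerA divff ?gt_eqF// scale1r scalerBl scale1r opprB.
  by rewrite (addrA (z - w)) subrKA [RHS]addrAC subrKA.
move=> /le_trans/(_ (cauchy_schwarz _ _)); rewrite inner_normE.
have [->|pq0] := eqVneq (p - q) 0.
  by rewrite normr0 addr_ge0// mulr_ge0.
rewrite expr2 ler_pM2l ?normr_gt0// => /le_trans; apply.
by apply: le_trans (ler_normD _ _) _; rewrite normrZ.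
Qed.

Lemma cocoercive_lipschitz (T : H -> H) (L : R) x y : 0 < L ->
  cocoercive inner L^-1 T -> `|T x - T y| <= L * `|x - y|.
Proof.
move=> L0 [_ /(_ x y)]; have [->|Txy] := eqVneq (T x - T y) 0.
  by rewrite normr0 mulr_ge0// ltW.
move=> /le_trans/(_ (cauchy_schwarz _ _)).
by rewrite expr2 mulrA ler_pM2r ?normr_gt0// ler_pdivrMl.
Qed.

End Hilbert.

(** * Absolute continuity and uniqueness *)

Section ProdComplete.
Context {R : realType} {U V : completeNormedModType R}.

HB.instance Definition _ := NormedModule.on (U * V)%type.

(** Makes H * H a complete state space, as the Cauchy-Lipschitz theorem requires. *)
Lemma prod_complete (F : set_system (U * V)%type) :
  ProperFilter F -> cauchy F -> cvg F.
Proof.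
move=> FF /cauchy_ballP cF.
have /cvg_ex[l Fl] : cvg (fst @ F).
  apply/cauchy_cvgP/cauchy_exP => e e0.
  have [[A B] [FA FB] AB] := cF e e0; have [x Ax] := filter_ex FA.
  by exists x.1; apply: filterS FB => y By; exact: (AB (x, y) (conj Ax By)).1.
have /cvg_ex[m Fm] : cvg (snd @ F).
  apply/cauchy_cvgP/cauchy_exP => e e0.
  have [[A B] [FA FB] AB] := cF e e0; have [x Ax] := filter_ex FA.
  by exists x.2; apply: filterS FB => y By; exact: (AB (x, y) (conj Ax By)).2.
apply/cvg_ex; exists (l, m); apply/cvg_ballP => e e0.
move/cvg_ballP/(_ e e0) : Fl => Fl; move/cvg_ballP/(_ e e0) : Fm => Fm.
by apply: filterS2 Fl Fm => x; split.
Qed.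

HB.instance Definition _ := Uniform_isComplete.Build (U * V)%type prod_complete.

End ProdComplete.

Section AbsolutelyContinuous.
Context {R : realType} {V : completeNormedModType R}.
Implicit Types (f g : R -> V) (b r s t : R) (v : V).

Lemma eq_absolutely_continuous f g b :
  (forall t, 0 <= t -> f t = g t) ->
  absolutely_continuous_on 0 b f -> absolutely_continuous_on 0 b g.
Proof.
move=> fg acf e e0; have [d d0 fd] := acf e e0; exists d => // n l r lr tlr lrd.
under eq_bigr => k _ do
  (have [l0 [lrk rb]] := lr k; rewrite -!fg//; last exact: le_trans lrk).
exact: fd.
Qed.

(** Covers differences, pairs and components at once. *)
Lemma absolutely_continuous_dominated (U W : completeNormedModType R)
    (f : R -> U) (g : R -> W) (h : R -> V) b :
  (forall s t, `|h t - h s| <= `|f t - f s| + `|g t - g s|) ->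
  absolutely_continuous_on 0 b f -> absolutely_continuous_on 0 b g ->
  absolutely_continuous_on 0 b h.
Proof.
move=> hfg acf acg e e0.
have [d1 d10 fd] := acf _ (divr_gt0 e0 (ltr0n _ 2)).
have [d2 d20 gd] := acg _ (divr_gt0 e0 (ltr0n _ 2)).
exists (Num.min d1 d2); first by rewrite lt_min d10.
move=> n l r lr tlr; rewrite lt_min => /andP[lr1 lr2].
apply: le_lt_trans (ler_sum _ (fun k _ => hfg (l k) (r k))) _.
rewrite big_split/=; have := fd n l r lr tlr lr1; have := gd n l r lr tlr lr2.
lra.
Qed.

Lemma lipschitz_absolutely_continuous f b (M : R) : 0 < M ->
  (forall s t, 0 <= s -> s <= t -> t <= b -> `|f t - f s| <= M * (t - s)) ->
  absolutely_continuous_on 0 b f.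
Proof.
move=> M0 fM e e0; exists (e / M); first exact: divr_gt0.
move=> n l r lr _; rewrite ltr_pdivlMr// mulrC mulr_sumr.
apply: le_lt_trans; apply: ler_sum => k _.
by have [? [? ?]] := lr k; exact: fM.
Qed.

Lemma locally_absolutely_continuous_continuous f :
  locally_absolutely_continuous f -> continuous_nneg f.
Proof.
move=> acf t t0 e e0; have t10 : 0 < t + 1 by lra.
have [d d0 fd] := acf _ t10 e e0.
have step s s' : 0 <= s -> s <= s' -> s' <= t + 1 -> s' - s < d ->
    `|f s' - f s| <= e.
  move=> s0 ss' s't ssd.
  have := fd 1%N (fun=> s) (fun=> s'); rewrite !big_ord1 => /(_ _ _ _)/ltW.
  by apply => // i j _ _ _; rewrite !ord1.
exists (Num.min 1 d); first by rewrite lt_min ltr01.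
move=> s s0; rewrite lt_min => /andP[st1 std].
have [st|ts] := leP s t.
  by rewrite distrC; apply: step => //; move: std; rewrite ltr_norml; lra.
by apply: step => //; move: st1 std; rewrite !ltr_norml; lra.
Qed.

Lemma straddle_deriv_absolutely_continuous f (f' : R -> V) :
  continuous_nneg f' -> (forall t, 0 <= t -> straddle_deriv f t (f' t)) ->
  locally_absolutely_continuous f.
Proof.
move=> cf' ff' b b0; have [M M0 f'M] := continuous_nneg_bounded cf' (ltW b0).
apply: (@lipschitz_absolutely_continuous _ _ M) => // s t s0 st tb.
(* The mean value inequality starts at 0, so f is translated by s. *)
have := @straddle_deriv_growth _ _ (fun r => f (s + r)) (fun r => M * r) (t - s).
rewrite addr0 mulr0 subr0 subrKC; apply; first lra.
move=> r /andP[r0 rt] e e0; have sr0 : 0 <= s + r by lra.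
have [d d0 fd] := ff' (s + r) sr0 e e0.
exists d => // u u' u0 ur ru' u't uud.
have u'u : 0 <= u' - u by lra.
have suE : s + u' - (s + u) = u' - u by ring.
have := fd (s + u) (s + u'); rewrite suE.
move=> /(_ ltac:(lra) ltac:(lra) ltac:(lra) uud).
have := ler_wpM2l u'u (f'M (s + r) ltac:(lra)).
have := ler_distD ((u' - u) *: f' (s + r)) (f (s + u') - f (s + u)) 0.
by rewrite !subr0 normrZ (ger0_norm u'u); lra.
Qed.

End AbsolutelyContinuous.

(** Repeated halving replaces Gronwall's lemma and needs only the mean value inequality off the null
    set where one of the two equations fails. *)
Lemma caratheodory_unique (R : realType) (V : completeNormedModType R)
    (F : R -> V -> V) (X Y : R -> V) :
  (forall b : R, 0 <= b -> exists2 K, 0 < K &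
    forall t, 0 <= t <= b -> forall x y, `|F t x - F t y| <= K * `|x - y|) ->
  locally_absolutely_continuous X -> locally_absolutely_continuous Y ->
  {ae (@lebesgue_measure R), forall t, 0 <= t ->
    straddle_deriv X t (F t (X t))} ->
  {ae (@lebesgue_measure R), forall t, 0 <= t ->
    straddle_deriv Y t (F t (Y t))} ->
  X 0 = Y 0 -> forall t, 0 <= t -> X t = Y t.
Proof.
move=> F_lip acX acY dX dY XY0 b b0; have [K K0 FK] := F_lip b b0.
pose Z t := X t - Y t.
have acZ c : 0 < c -> absolutely_continuous_on 0 c Z.
  move=> c0; apply: absolutely_continuous_dominated (acX c c0) (acY c c0).
  by move=> s t; rewrite /Z opprD addrACA -opprD; exact: ler_normB.
have [M M0 ZM] := continuous_nneg_bounded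
  (locally_absolutely_continuous_continuous acZ) b0.
have Z0 : Z 0 = 0 by rewrite /Z XY0 subrr.
pose c := 2 * K; have c0 : 0 < c by rewrite mulr_gt0.
have ZE n t : 0 <= t <= b -> `|Z t| <= M / 2 ^+ n * expR (c * t).
  elim: n t => [|n IHn] t tb.
    apply: le_trans (ZM t tb) _; rewrite expr0 divr1 ler_peMr//; first exact: ltW.
    rewrite -expR0 ler_expR mulr_ge0//; lra.
  have [->|t_neq0] := eqVneq t 0.
    by rewrite Z0 normr0 mulr_ge0 ?expR_ge0// divr_ge0 ?exprn_ge0// ltW.
  have t_gt0 : 0 < t by rewrite lt_neqAle eq_sym t_neq0; lra.
  have Mn0 : 0 <= M / 2 ^+ n.+1 by rewrite divr_ge0 ?exprn_ge0// ltW.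
  have := @absolutely_continuous_growth _ _ Z
    (fun s => M / 2 ^+ n.+1 * expR (c * s)) _ t (ltW t_gt0) (acZ t t_gt0)
    _ (negligibleU dX dY).
  rewrite Z0 subr0 mulr0 expR0 mulr1 => /(_ _ _)/le_trans; apply.
  - move=> s s' s0 ss' s't; rewrite ler_wpM2l// ler_expR ler_pM2l//.
  - move=> r /andP[r0 rt] /not_orP[/contrapT dXr /contrapT dYr] e e0.
    have dZr := straddle_derivB (dXr r0) (dYr r0).
    have vb : `|F r (X r) - F r (Y r)| <= M / 2 ^+ n.+1 * (c * expR (c * r)).
      apply: le_trans (FK r ltac:(lra) _ _) _.
      have -> : M / 2 ^+ n.+1 * (c * expR (c * r)) =
          K * (M / 2 ^+ n * expR (c * r)).
        by rewrite /c exprS; field; rewrite expf_neq0.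
      by rewrite ler_pM2l// IHn//; lra.
    have [d d0 Zd] := straddle_deriv_exp_growth c0 Mn0 dZr vb e0.
    by exists d => // s s' s0 sr rs' s't; exact: Zd.
  by rewrite gerBl.
apply: norm_le_eq => e e0.
have [n ne] := geometric_small (M * expR (c * b)) e0.
by apply: le_trans ne; rewrite mulrAC; apply: ZE; rewrite b0 lexx.
Qed.

(** * Difference quotients on the half-line and straddled derivatives *)

Section DerivNneg.
Context {R : realType} {H : completeNormedModType R}.
Implicit Types (f g : R -> H) (t : R) (v : H).

Lemma eq_straddle_deriv f g t v : (forall s, 0 <= s -> f s = g s) -> 0 <= t ->
  straddle_deriv f t v -> straddle_deriv g t v.
Proof.
move=> fg t0 fv e e0; have [d d0 fd] := fv e e0; exists d => // s s' s0 st ts'.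
by rewrite -!fg//; [exact: fd | exact: le_trans ts'].
Qed.

(** Makes the limit of difference quotients unique; the points t + d / 2 serve also at t = 0. *)
Lemma nneg_dnbhs_proper t : 0 <= t -> ProperFilter (within `[0, +oo[%classic t^').
Proof.
move=> t0; apply: Build_ProperFilter_ex => P /nbhs_ballP[d /= d0 dP].
exists (t + d / 2); apply: dP; rewrite /ball/=.
- by rewrite opprD addNKr normrN ger0_norm; lra.
- by rewrite -subr_eq0 addrC addKr; apply/eqP; lra.
- by rewrite in_itv/= andbT; lra.
Qed.

Lemma straddle_deriv_cvg f t v : 0 <= t -> straddle_deriv f t v ->
  diff_quot_nneg f t --> v.
Proof.
move=> t0 fv; rewrite /diff_quot_nneg; apply/cvgrPdist_le => e e0.
have [d d0 fd] := fv e e0.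
apply/nbhs_ballP; exists d => // s; rewrite /ball/= => tsd st.
rewrite /= in_itv/= andbT => s0.
have st0 : 0 < `|s - t| by rewrite normr_gt0 subr_eq0.
have key : `|f s - f t - (s - t) *: v| <= e * `|s - t|.
  have [s_t|t_s] := leP s t.
    have := fd s t s0 s_t (lexx _); rewrite ler0_norm; last lra.
    rewrite ger0_norm ?opprB in tsd *; last lra.
    move=> /(_ tsd); rewrite -normrN; congr (_ <= _).
    by rewrite !opprD !opprK -scaleNr opprB (addrC (- f t)).
  have := fd t s t0 (lexx _) (ltW t_s); rewrite gtr0_norm; last lra.
  by rewrite distrC gtr0_norm in tsd; [exact | lra].
rewrite -(ler_pM2r st0) mulrC -normrZ scalerBr scalerA divff; last first.
  by rewrite subr_eq0.
by rewrite scale1r distrC.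
Qed.

(** The increment from s to s' splits at t, and the errors e * (t - s) and e * (s' - t) add up to e
    * (s' - s). *)
Lemma cvg_straddle_deriv f t v : 0 <= t -> diff_quot_nneg f t --> v ->
  straddle_deriv f t v.
Proof.
move=> t0 /cvgrPdist_le fv e e0.
have /nbhs_ballP[d /= d0 fd] := fv e e0.
have key s : 0 <= s -> `|s - t| < d ->
    `|f s - f t - (s - t) *: v| <= e * `|s - t|.
  move=> s0 std; have [->|st] := eqVneq s t.
    by rewrite !subrr scale0r subrr !normr0 mulr0.
  have st0 : 0 < `|s - t| by rewrite normr_gt0 subr_eq0.
  have := fd s; rewrite /ball/= distrC => /(_ std st).
  rewrite /= in_itv/= andbT => /(_ s0).
  rewrite -(ler_pM2r st0) mulrC -normrZ scalerBr scalerA divff; last first.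
    by rewrite subr_eq0.
  by rewrite scale1r distrC.
exists d => // s s' s0 st ts' ssd; have s'0 : 0 <= s' by lra.
have := key s s0 ltac:(rewrite ler0_norm; lra).
have := key s' s'0 ltac:(rewrite ger0_norm; lra).
rewrite (ger0_norm (_ : 0 <= s' - t)); last lra.
rewrite (ler0_norm (_ : s - t <= 0)); last lra.
have -> : f s' - f s - (s' - s) *: v =
    (f s' - f t - (s' - t) *: v) - (f s - f t - (s - t) *: v).
  have -> : s' - s = (s' - t) - (s - t) by ring.
  rewrite scalerBl -(subrKA (f t) (f s')) -(opprB (f s)).
  by rewrite !opprD [LHS]addrACA.
have := ler_normB (f s' - f t - (s' - t) *: v) (f s - f t - (s - t) *: v).
lra.
Qed.

Lemma derivable_nneg_straddle f t : 0 <= t -> derivable_nneg f t ->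
  straddle_deriv f t (deriv_nneg f t).
Proof. by move=> t0; exact: cvg_straddle_deriv. Qed.

Lemma straddle_derivable_nneg f t v : 0 <= t -> straddle_deriv f t v ->
  derivable_nneg f t /\ deriv_nneg f t = v.
Proof.
move=> t0 /(straddle_deriv_cvg t0) fv; have := nneg_dnbhs_proper t0 => FF.
split; first by apply/cvg_ex; exists v.
exact: cvg_lim fv.
Qed.

End DerivNneg.

(** * The dynamical system *)

Section ContinuousNneg.
Context {R : realType} {V : completeNormedModType R}.

Lemma continuous_nnegP (f : R -> V) : continuous_nneg f <->
  forall t : R, 0 <= t -> f s @[s --> within `[0, +oo[%classic (nbhs t)] --> f t.
Proof.
split=> cf t t0.
  apply/cvgrPdist_le => e e0; have [d d0 fd] := cf t t0 e e0.
  apply/nbhs_ballP; exists d => // s; rewrite /ball/= => std.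
  rewrite in_itv/= andbT => s0.
  by rewrite distrC; apply: fd => //; rewrite distrC.
move=> e e0; have /cvgrPdist_le/(_ e e0)/nbhs_ballP[d /= d0 fd] := cf t t0.
exists d => // s s0 std; rewrite distrC; apply: fd.
  by rewrite /ball/= distrC.
by rewrite /= in_itv/= andbT.
Qed.

Lemma within_continuous_nneg (f : R -> V) :
  (forall b, 0 < b -> {within `[0, b], continuous f}) -> continuous_nneg f.
Proof.
move=> cf t t0 e e0; have b0 : 0 < t + 1 by lra.
have /subspace_continuousP/(_ t) := cf _ b0.
rewrite /= in_itv/= t0 lerDl ler01 => /(_ isT) /cvgrPdist_le/(_ e e0).
move=> /nbhs_ballP[d /= d0 fd].
exists (Num.min 1 d); first by rewrite lt_min ltr01.
move=> s s0; rewrite lt_min => /andP[st1 std]; rewrite distrC; apply: fd.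
  by rewrite /ball/= distrC.
by rewrite /= in_itv/= s0/=; move: st1; rewrite ltr_norml; lra.
Qed.

End ContinuousNneg.

Lemma prod_norm_le (R : realType) (U V : completeNormedModType R)
    (x : U * V) (a : R) :
  (`|x| <= a) = (`|x.1| <= a) && (`|x.2| <= a).
Proof. by rewrite prod_normE ge_max. Qed.

Section Resolvent.
Context {R : realType} {H : completeNormedModType R}.
Variable inner : {dot H for idfun}.
Hypothesis Hhilbert : hilbert_norm inner.
Variable A : H -> set H.
Hypothesis mA : maximally_monotone inner A.

Lemma resolvent_nonexpansive (l : R) z w : 0 < l ->
  `|resolvent l A z - resolvent l A w| <= `|z - w|.
Proof.
move=> l0; apply: le_trans (resolvent_dist Hhilbert z w mA l0 l0) _.
by rewrite divff ?gt_eqF// subrr normr0 mul0r addr0.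
Qed.

Lemma resolvent_continuous_nneg (l : R -> R^o) (z : R -> H) :
  (forall t, 0 <= t -> 0 < l t) -> continuous_nneg l -> continuous_nneg z ->
  continuous_nneg (fun t => resolvent (l t) A (z t)).
Proof.
move=> l0 cl cz t t0 e e0; pose W := `|z t - resolvent (l t) A (z t)| + 1.
have W0 : 0 < W by rewrite ltr_wpDl.
have lt0 := l0 t t0.
have [d1 d10 zd] := cz t t0 _ (divr_gt0 e0 (ltr0n _ 2)).
have e'0 : 0 < e / 2 / W * l t by rewrite mulr_gt0// divr_gt0// divr_gt0.
have [d2 d20 ld] := cl t t0 _ e'0.
exists (Num.min d1 d2); first by rewrite lt_min d10.
move=> s s0; rewrite lt_min => /andP[st1 st2].
apply: le_trans (resolvent_dist Hhilbert _ _ mA (l0 s s0) lt0) _.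
have : `|1 - l s / l t| <= e / 2 / W.
  have -> : 1 - l s / l t = (l t - l s) / l t by field; rewrite gt_eqF.
  rewrite normrM normfV (gtr0_norm lt0) ler_pdivrMr// distrC.
  exact: ld.
rewrite -(ler_pM2r W0) divfK ?gt_eqF// /W => lsW.
have := zd s s0 st1; have := normr_ge0 (1 - l s / l t).
by move: lsW; nra.
Qed.

End Resolvent.

Section DynamicalSystem.
Context {R : realType} {H : completeNormedModType R}.
Variables (A : H -> set H) (D B : H -> H) (gamma lambda beta : R -> R).

Definition forward_backward (t : R) (x : H) : H :=
  resolvent (lambda t) A
    (x - lambda t *: D x - (lambda t * beta t) *: B x).

Definition first_order_field (t : R) (X : (H * H)%type) : (H * H)%type :=
  (X.2, forward_backward t X.1 - gamma t *: X.2 - X.1).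

Variable inner : {dot H for idfun}.
Hypothesis Hhilbert : hilbert_norm inner.
Hypothesis mA : maximally_monotone inner A.
Variables (LD LB : R).
Hypothesis (LD_gt0 : 0 < LD) (LB_gt0 : 0 < LB).
Hypothesis (HD : cocoercive inner LD^-1 D) (HB : cocoercive inner LB^-1 B).
Hypothesis lambda_gt0 : forall t, 0 <= t -> 0 < lambda t.
Hypothesis (gamma_cont : continuous_nneg (gamma : R -> R^o))
  (lambda_cont : continuous_nneg (lambda : R -> R^o))
  (beta_cont : continuous_nneg (beta : R -> R^o)).

Lemma lambda_beta_continuous :
  continuous_nneg ((fun t => lambda t * beta t) : R -> R^o).
Proof.
apply/continuous_nnegP => t t0.
move/continuous_nnegP/(_ t t0) : lambda_cont => cl.
move/continuous_nnegP/(_ t t0) : beta_cont => cb.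
exact: cvgM cl cb.
Qed.

Lemma first_order_field_lipschitz b : 0 <= b -> exists2 K, 0 < K &
  forall t, 0 <= t <= b -> forall X Y,
    `|first_order_field t X - first_order_field t Y| <= K * `|X - Y|.
Proof.
move=> b0; have [Mg Mg0 gM] := continuous_nneg_bounded gamma_cont b0.
have [Ml Ml0 lM] := continuous_nneg_bounded lambda_cont b0.
have [Mb Mb0 bM] := continuous_nneg_bounded lambda_beta_continuous b0.
have l0 := mulr_gt0 Ml0 LD_gt0; have lb0 := mulr_gt0 Mb0 LB_gt0.
(* The first three terms come from the argument of the resolvent, with Mb a bound for lambda * beta;
   Mg comes from the damping and the last 1 from the term -x. *)
exists (1 + Ml * LD + Mb * LB + Mg + 1); first lra.
move=> t tb X Y; have t0 : 0 <= t by lra.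
have := lexx `|X - Y|; rewrite prod_norm_le /= => /andP[X1 X2].
have XY0 := normr_ge0 (X - Y).
move: (`|X - Y|) X1 X2 XY0 => N X1 X2 N0.
have fb : `|forward_backward t X.1 - forward_backward t Y.1| <=
    (1 + Ml * LD + Mb * LB) * N.
  apply: le_trans (resolvent_nonexpansive Hhilbert mA _ _ (lambda_gt0 t0)) _.
  have -> : X.1 - lambda t *: D X.1 - (lambda t * beta t) *: B X.1 -
    (Y.1 - lambda t *: D Y.1 - (lambda t * beta t) *: B Y.1) =
    X.1 - Y.1 - lambda t *: (D X.1 - D Y.1) -
      (lambda t * beta t) *: (B X.1 - B Y.1).
    by rewrite !scalerBr !opprD [LHS]addrACA (addrACA X.1).
  have DL := cocoercive_lipschitz Hhilbert X.1 Y.1 LD_gt0 HD.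
  have BL := cocoercive_lipschitz Hhilbert X.1 Y.1 LB_gt0 HB.
  have lD : `|lambda t *: (D X.1 - D Y.1)| <= Ml * (LD * N).
    rewrite normrZ ler_pM//; first exact: lM.
    by apply: le_trans DL _; rewrite ler_pM2l.
  have lB : `|(lambda t * beta t) *: (B X.1 - B Y.1)| <= Mb * (LB * N).
    rewrite normrZ ler_pM//; first exact: bM.
    by apply: le_trans BL _; rewrite ler_pM2l.
  apply: le_trans (ler_normB _ _) _.
  have := ler_normB (X.1 - Y.1) (lambda t *: (D X.1 - D Y.1)).
  lra.
rewrite prod_norm_le /=; apply/andP; split.
  apply: le_trans X2 _; rewrite ler_peMl//; lra.
have -> : forward_backward t X.1 - gamma t *: X.2 - X.1 -
    (forward_backward t Y.1 - gamma t *: Y.2 - Y.1) =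
    forward_backward t X.1 - forward_backward t Y.1 -
    gamma t *: (X.2 - Y.2) - (X.1 - Y.1).
  by rewrite !scalerBr !opprD [LHS]addrACA (addrACA (forward_backward t X.1)).
have gN : `|gamma t *: (X.2 - Y.2)| <= Mg * N.
  by rewrite normrZ ler_pM//; exact: gM.
apply: le_trans (ler_normB _ _) _.
have := ler_normB (forward_backward t X.1 - forward_backward t Y.1)
  (gamma t *: (X.2 - Y.2)).
lra.
Qed.

Lemma first_order_field_continuous X : continuous_nneg (first_order_field ^~ X).
Proof.
apply/continuous_nnegP => t t0; apply: cvg_pair; first exact: cvg_cst.
move/continuous_nnegP/(_ t t0) : (gamma_cont) => cg.
apply: cvgB; last exact: cvg_cst.
apply: cvgB; last by apply: cvgZr_tmp; exact: cg.
move: t t0 {cg}; apply/continuous_nnegP.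
apply: (resolvent_continuous_nneg Hhilbert mA) => //.
apply/continuous_nnegP => s s0.
move/continuous_nnegP/(_ s s0) : (lambda_cont) => cl.
move/continuous_nnegP/(_ s s0) : lambda_beta_continuous => clb.
apply: cvgB; last by apply: cvgZr_tmp; exact: clb.
apply: cvgB; last by apply: cvgZr_tmp; exact: cl.
exact: cvg_cst.
Qed.

End DynamicalSystem.

Lemma straddle_deriv_pair (R : realType) (U V : completeNormedModType R)
    (f : R -> U) (g : R -> V) (t : R) (v : U) (w : V) :
  straddle_deriv (fun s => (f s, g s) : (U * V)%type) t (v, w) <->
  straddle_deriv f t v /\ straddle_deriv g t w.
Proof.
split=> [fg|[fv gw] e e0].
  split=> e e0; have [d d0 fgd] := fg e e0; exists d => // s s' s0 st ts' ssd.
    by have := fgd s s' s0 st ts' ssd; rewrite prod_norm_le => /andP[].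
  by have := fgd s s' s0 st ts' ssd; rewrite prod_norm_le => /andP[].
have [d1 d10 fd] := fv e e0; have [d2 d20 gd] := gw e e0.
exists (Num.min d1 d2); first by rewrite lt_min d10.
move=> s s' s0 st ts'; rewrite lt_min => /andP[ss1 ss2].
by rewrite prod_norm_le /= fd ?gd.
Qed.

Lemma absolutely_continuous_pair (R : realType) (U V : completeNormedModType R)
    (f : R -> U) (g : R -> V) :
  locally_absolutely_continuous f -> locally_absolutely_continuous g ->
  locally_absolutely_continuous (fun s => (f s, g s) : (U * V)%type).
Proof.
move=> acf acg b b0.
apply: absolutely_continuous_dominated (acf b b0) (acg b b0) => s t.
by rewrite prod_norm_le /= lerDl lerDr !normr_ge0.
Qed.

Theorem theorem2 (R : realType) (H : completeNormedModType R)
    (inner : {dot H for idfun}) (Hhilbert : hilbert_norm inner)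
    (A : H -> set H) (HA : maximally_monotone inner A)
    (D B : H -> H) (LD LB : R) (LD_gt0 : 0 < LD) (LB_gt0 : 0 < LB)
    (HD : cocoercive inner LD^-1 D) (HB : cocoercive inner LB^-1 B)
    (gamma lambda beta : R -> R)
    (gamma_gt0 : forall t, 0 <= t -> 0 < gamma t)
    (lambda_gt0 : forall t, 0 <= t -> 0 < lambda t)
    (beta_gt0 : forall t, 0 <= t -> 0 < beta t)
    (gamma_cont : forall b, 0 < b -> {within `[0, b], continuous gamma})
    (lambda_cont : forall b, 0 < b -> {within `[0, b], continuous lambda})
    (beta_cont : forall b, 0 < b -> {within `[0, b], continuous beta})
    (u0 v0 : H) :
  exists x : R -> H,
    strong_global_solution A D B gamma lambda beta u0 v0 x /\
    forall y : R -> H,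
      strong_global_solution A D B gamma lambda beta u0 v0 y ->
      forall t, 0 <= t -> y t = x t.
Proof.
have cg : continuous_nneg (gamma : R -> R^o) by exact: within_continuous_nneg.
have cl : continuous_nneg (lambda : R -> R^o) by exact: within_continuous_nneg.
have cb : continuous_nneg (beta : R -> R^o) by exact: within_continuous_nneg.
have F_lip := first_order_field_lipschitz Hhilbert HA LD_gt0 LB_gt0 HD HB
  lambda_gt0 cg cl cb.
have F_cont := first_order_field_continuous D B Hhilbert HA lambda_gt0 cg cl cb.
have [X X0 dX] := cauchy_lipschitz (u0, v0) F_lip F_cont.
pose x t := (X t).1; pose w t := (X t).2.
have dxw t : 0 <= t -> straddle_deriv x t (w t) /\ straddle_deriv w t
    (forward_backward A D B lambda beta t (x t) - gamma t *: w t - x t).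
  move=> t0; apply/straddle_deriv_pair; have := dX t t0.
  by rewrite /first_order_field /=; congr straddle_deriv; apply/funext => s.
have acX : locally_absolutely_continuous X.
  apply: straddle_deriv_absolutely_continuous (dX).
  exact: (lipschitz_comp_continuous F_lip F_cont (straddle_deriv_continuous dX)).
have acx : locally_absolutely_continuous x.
  apply: straddle_deriv_absolutely_continuous (fun t t0 => (dxw t t0).1).
  exact: straddle_deriv_continuous (fun t t0 => (dxw t t0).2).
have x'E t : 0 <= t -> deriv_nneg x t = w t.
  by move=> t0; have [] := straddle_derivable_nneg t0 (dxw t t0).1.
have acw : locally_absolutely_continuous w.
  move=> b b0.
  (* [X] serves as both dominating functions. *)
  apply: absolutely_continuous_dominated (acX b b0) (acX b b0) => s t.
  apply: le_trans (_ : `|X t - X s| <= _); last by rewrite lerDl.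
  by have := lexx `|X t - X s|; rewrite {1}prod_norm_le => /andP[].
exists x; split.
  split.
  - exact: acx.
  - by move=> t t0; have [] := straddle_derivable_nneg t0 (dxw t t0).1.
  - move=> b b0; apply: eq_absolutely_continuous (acw b b0) => t t0.
    by rewrite x'E.
  - apply: aeW => t t0.
    have dx' : straddle_deriv (deriv_nneg x) t
        (forward_backward A D B lambda beta t (x t) - gamma t *: w t - x t).
      by apply: eq_straddle_deriv t0 (dxw t t0).2 => s s0; rewrite x'E.
    have [? ->] := straddle_derivable_nneg t0 dx'; split=> //.
    by rewrite x'E// addrAC subrK subrK.
  - by rewrite /x X0.
  - by rewrite x'E// /w X0.
move=> y [acy dery acy' odey y0 y'0] t t0.
(* [Y] solves the first order system almost everywhere: y is differentiable at every time, its
   derivative at almost every time. *)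
pose Y s : (H * H)%type := (y s, deriv_nneg y s).
have acY : locally_absolutely_continuous Y by exact: absolutely_continuous_pair.
have dY : {ae (@lebesgue_measure R), forall s, 0 <= s -> straddle_deriv Y s
    (first_order_field A D B gamma lambda beta s (Y s))}.
  apply: negligibleS odey => s /= ns ode; apply: ns => s0.
  have [dery' odeE] := ode s0.
  apply/straddle_deriv_pair; split.
    exact: derivable_nneg_straddle (dery s s0).
  rewrite /forward_backward -odeE addrAC !addrK.
  exact: derivable_nneg_straddle.
have dX' : {ae (@lebesgue_measure R), forall s, 0 <= s -> straddle_deriv X s
    (first_order_field A D B gamma lambda beta s (X s))}.
  by apply: aeW => s; exact: dX.
have XY0 : Y 0 = X 0 by rewrite X0 /Y y0 y'0.
have -> : y t = (Y t).1 by [].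
by rewrite (caratheodory_unique F_lip acY acX dY dX' XY0 t0).
Qed.
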